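(* Fix a real $\varepsilon > 0$ and an integer $r \ge 2$. For any sufficiently large $Q \ge 1$, for all but at most $Q^{1-2r\varepsilon + o(1)}$ integers $q \in [Q,2Q]$, the following holds: for every interval $\mathcal{J} = \{L+1, \ldots, L+N\} \subseteq [1,q-1]$ of $N$ consecutive integers and every sequence of complex weights $\mathcal{A} = \{\alpha_m\}_{m \in \mathbb{Z}_q^*}$, the sum $$ \mathcal{S}_q(\mathcal{A};\mathcal{J}) = \sum_{m\in \mathbb{Z}_q^*} \sum_{n \in \mathcal{J}} \alpha_m \mathcal{K}_q(m,n) $$ satisfies $$ \mathcal{S}_q(\mathcal{A};\mathcal{J}) \ll \|\mathcal{A}\|_1^{1-1/r} \|\mathcal{A}\|_2^{1/r} \left(q + N^{1/2} q^{1/2+1/(2r)}\right) q^{\varepsilon + o(1)}. $$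
   Context: $\mathbb{Z}_q$ is the residue ring modulo $q$ and $\mathbb{Z}_q^*$ is its group of units. For integers $m,n$ the Kloosterman sum is $$ \mathcal{K}_q(m,n) = \sum_{x \in \mathbb{Z}_q^*} \mathbf{e}_q(mx + n\overline{x}), $$ where $\overline{x}$ is the multiplicative inverse of $x$ modulo $q$ and $\mathbf{e}_q(z) = \exp(2\pi i z/q)$. For $\sigma>0$, $\|\mathcal{A}\|_\sigma = \left(\sum_{m \in \mathbb{Z}_q^*} |\alpha_m|^\sigma\right)^{1/\sigma}$. $A \ll B$ means $|A| \le cB$ with a constant $c>0$, which here may depend on $\varepsilon$ and $r$. The $o(1)$ notation means: for every $\delta>0$ there are $Q_0$ and $C$ depending only on $\varepsilon, r, \delta$ such that for all $Q \ge Q_0$ the number of exceptional $q \in [Q,2Q]$ is at most $Q^{1-2r\varepsilon+\delta}$, and for each non-exceptional $q$ the bound holds with implied constant $C$ and with $q^{\varepsilon+o(1)}$ replaced by $q^{\varepsilon+\delta}$, uniformly in $\mathcal{J}$ and $\mathcal{A}$. *)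

(* Defs.v *)
From HB Require Import structures.
From mathcomp Require Import all_boot all_order all_algebra fingroup.
From mathcomp Require Import complex finmap.
From mathcomp Require Import all_classical all_reals all_analysis.
Set Implicit Arguments.
Unset Strict Implicit.
Unset Printing Implicit Defensive.
Import Order.TTheory GRing.Theory Num.Theory.
Local Open Scope ring_scope.
Local Open Scope complex_scope.

(* [e_mod R q z] is exp(2 pi i z / q). *)
Definition e_mod (R : realType) (q : nat) (z : int) : R[i] :=
  cos (2 * pi * z%:~R / q%:R) +i* sin (2 * pi * z%:~R / q%:R).

(* The representative in {0, ..., q-1} of a unit modulo q.  As 'Z_q stands for
   the residue ring modulo q only when 1 < q, so do the definitions below. *)
Definition unit_repr (q : nat) (x : {unit 'Z_q}) : nat := (val x : 'Z_q).

Definition kloosterman (R : realType) (q : nat) (m n : int) : R[i] :=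
  \sum_(x : {unit 'Z_q})
    e_mod R q (m * (unit_repr x)%:Z + n * (unit_repr (x^-1)%g)%:Z).

Definition weight_norm (R : realType) (q : nat) (sigma : R)
    (alpha : {unit 'Z_q} -> R[i]) : R :=
  (\sum_(m : {unit 'Z_q}) Normc.normc (alpha m) `^ sigma) `^ sigma^-1.

(* The inner sum runs over the interval {L+1, ..., L+N}. *)
Definition kloosterman_bilinear (R : realType) (q : nat)
    (alpha : {unit 'Z_q} -> R[i]) (L N : nat) : R[i] :=
  \sum_(m : {unit 'Z_q}) \sum_(L.+1 <= n < (L + N).+1)
    alpha m * kloosterman R q (unit_repr m)%:Z n%:Z.

(* Main.v *)
Require Import Defs.
From HB Require Import structures.
From mathcomp Require Import all_boot all_order all_algebra fingroup.
From mathcomp Require Import complex finmap.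
From mathcomp Require Import all_classical all_reals all_analysis.
From mathcomp Require Import ring lra zify.
Set Implicit Arguments.
Unset Strict Implicit.
Unset Printing Implicit Defensive.
Import Order.TTheory GRing.Theory Num.Theory.
Import numFieldNormedType.Exports.

(**
  Opening the Kloosterman sums gives [S = \sum_m alpha_m G_m] with
  [G_m = \sum_x F(x) e_q(m / x)] and [F(x) = \sum_(n in J) e_q(n x)], where
  [|F(x)| <= min (N, q / |x|)] for the representative [x] in the interval from [-q/2] to [q/2].  By
  Hoelder, [|S|^(2r) <= (\sum |alpha|)^(2r-2) (\sum |alpha|^2) (\sum_m |G_m|^(2r))],
  and by orthogonality the last factor is at most [q] times the sum of
  [\prod_i |F(x_i)|] over the solutions of
  [1/x_1 + ... + 1/x_r = 1/x_(r+1) + ... + 1/x_2r] modulo [q].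

  For the solutions of the equation over the rationals, let [V] be the lcm of the
  [x_i].  A prime power exactly dividing [V] divides at least two of the [x_i], so
  [V^2 <= \prod_i |x_i|] and [\prod_i |F(x_i)| <= (N q)^r / V]; as the [x_i] divide
  [V], the divisor bound makes their contribution [(N q)^r q^o(1)] for every [q].
  For the other solutions [q] divides the nonzero numerator of the difference of
  the two sides, and [\prod_i |F(x_i)| <= q^(2r) / \prod_i |x_i|].  Summed over [q],
  the weights [1 / \prod_i |x_i|] add up to [Q^o(1)], again by the divisor bound, so
  they exceed [q^(2 r eps - 1 + o(1))] for at most [Q^(1 - 2 r eps + o(1))] moduli.
*)

(** * The divisor bound in integer form *)

(** A divisor is determined by its exponent at [p], at most [a], and its prime-to-[p] part, which
    divides [m]. *)
Lemma size_divisors_pfactorM (p a m : nat) : prime p -> (0 < m)%N -> ~~ (p %| m)%N ->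
  (size (divisors (p ^ a * m)) <= a.+1 * size (divisors m))%N.
Proof.
move=> pp m0 pm; have pa0 : (0 < p ^ a)%N by rewrite expn_gt0 prime_gt0.
have pam0 : (0 < p ^ a * m)%N by rewrite muln_gt0 pa0.
rewrite -[a.+1](size_iota 0) -(size_allpairs (fun i e => p ^ i * e)%N).
apply: uniq_leq_size; first exact: divisors_uniq.
move=> d; rewrite -dvdn_divisors // => dm.
have d0 : (0 < d)%N by exact: dvdn_gt0 dm.
apply/allpairsP; exists (logn p d, d`_p^'); split; last by rewrite /= -p_part partnC.
  rewrite mem_iota add0n ltnS /=.
  move/(dvdn_leq_log p pam0): dm.
  by rewrite lognM // pfactorK // (lognE p m) (negPf pm) !andbF addn0.
rewrite -dvdn_divisors //=.
have cop : coprime d`_p^' (p ^ a).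
  by rewrite coprimeXr // coprime_sym prime_coprime // -p'natE // part_pnat.
by rewrite -(Gauss_dvdr _ cop); apply: dvdn_trans dm; exact: dvdn_part.
Qed.

(** Controls the cost of a small prime. With [b = a %/ k], [a + 1 <= k * (b + 1) <= k * 2 ^ b]; then
    take [k]-th powers. *)
Lemma expn_succ_bound (k a : nat) : (0 < k)%N -> (a.+1 ^ k <= k ^ k * 2 ^ a)%N.
Proof.
move=> k0; have h : (a.+1 <= k * 2 ^ (a %/ k))%N.
  apply: (@leq_trans (k * (a %/ k).+1)); first by rewrite mulnC; exact: ltn_ceil.
  by rewrite leq_mul2l ltn_expl // orbT.
apply: (@leq_trans ((k * 2 ^ (a %/ k)) ^ k)); first by rewrite leq_exp2r.
by rewrite expnMn leq_mul2l -expnM leq_exp2l // leq_divM orbT.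
Qed.

(** Large primes cost no constant: the factor [p ^ a] contributes
    [(a + 1) ^ k <= 2 ^ (a * k) <= p ^ a]. *)
Lemma size_divisors_bound_large (k n : nat) : (0 < k)%N -> (0 < n)%N ->
  (forall p, prime p -> p %| n -> 2 ^ k <= p)%N -> (size (divisors n) ^ k <= n)%N.
Proof.
move=> k0; elim/ltn_ind: n => n IH n0 hp.
have [n1|n1] := leqP n 1; first by rewrite (_ : n = 1%N) ?exp1n //; apply/eqP; rewrite eqn_leq n1.
set p := pdiv n; have pp : prime p by exact: pdiv_prime.
have pn : (p %| n)%N by exact: pdiv_dvd.
have m0 : (0 < n`_p^')%N by exact: part_gt0.
have npm : ~~ (p %| n`_p^')%N by rewrite -p'natE // part_pnat.
have nE : (n = p ^ logn p n * n`_p^')%N by rewrite -p_part partnC.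
have mn : (n`_p^' < n)%N.
  by rewrite {2}nE ltn_Pmull // -{1}(expn0 p) ltn_exp2l ?prime_gt1 // logn_gt0 mem_primes pp n0.
rewrite {1}nE.
apply: (@leq_trans (((logn p n).+1 * size (divisors n`_p^')) ^ k)).
  by rewrite leq_exp2r // size_divisors_pfactorM.
rewrite expnMn {3}nE leq_mul //; last first.
  by apply: IH => // l pl lm; apply: hp => //; apply: dvdn_trans lm (dvdn_part _ _).
apply: (@leq_trans ((2 ^ logn p n) ^ k)); first by rewrite leq_exp2r // ltn_expl.
by rewrite -expnM mulnC expnM leq_exp2r ?hp // logn_gt0 mem_primes pp n0.
Qed.

Lemma size_divisors_bound (k : nat) : (0 < k)%N ->
  exists2 C, (0 < C)%N & forall n, (0 < n)%N -> (size (divisors n) ^ k <= C * n)%N.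
Proof.
move=> k0.
suff H j : (j <= 2 ^ k)%N -> exists2 C, (0 < C)%N & forall n, (0 < n)%N ->
    (forall p, prime p -> p %| n -> 2 ^ k - j <= p)%N -> (size (divisors n) ^ k <= C * n)%N.
  have [C C0 hC] := H _ (leqnn _); exists C => // n n0; apply: hC => // p _ _.
  by rewrite subnn.
elim: j => [_|j IH jk].
  by exists 1%N => // n n0; rewrite subn0 mul1n; exact: size_divisors_bound_large.
have [C C0 hC] := IH (ltnW jk); set B := (2 ^ k - j.+1)%N.
have SB : (2 ^ k - j)%N = B.+1 by rewrite /B subnS prednK // subn_gt0.
exists (k ^ k * C)%N; first by rewrite muln_gt0 expn_gt0 k0.
move=> n n0 hp.
have [pB|npB] := boolP (prime B); last first.
  apply: (@leq_trans (C * n)).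
    apply: hC => // p pp pn; rewrite SB ltn_neqAle hp // andbT.
    by apply: contraNneq npB => ->.
  by rewrite leq_mul2r leq_pmull ?expn_gt0 ?k0 ?orbT.
have m0 : (0 < n`_B^')%N by exact: part_gt0.
have npm : ~~ (B %| n`_B^')%N by rewrite -p'natE // part_pnat.
have nE : (n = B ^ logn B n * n`_B^')%N by rewrite -p_part partnC.
rewrite {1}nE.
apply: (@leq_trans (((logn B n).+1 * size (divisors n`_B^')) ^ k)).
  by rewrite leq_exp2r // size_divisors_pfactorM.
rewrite expnMn {3}nE mulnACA leq_mul //.
  apply: leq_trans (expn_succ_bound _ k0) _.
  by rewrite leq_mul2l; apply/orP; right; case: (logn B n) => // l; rewrite leq_exp2r ?prime_gt1.
apply: hC => // p pp pm; rewrite SB ltn_neqAle hp ?andbT //; last first.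
  by apply: dvdn_trans pm (dvdn_part _ _).
by apply: contraNneq npm => Bp; rewrite {1}Bp.
Qed.

(** * Vanishing signed sums of unit fractions *)

Local Open Scope ring_scope.
Local Open Scope complex_scope.

(* The numerator of [\sum_i (-1) ^+ s i / x i] over the denominator [\prod_i x i]. *)
Definition recip_num (I : finType) (s : I -> bool) (x : I -> int) : int :=
  \sum_i (-1) ^+ s i * \prod_(j | j != i) x j.

Lemma pfactor_dvdn_biglcmn (I : finType) (a : I -> nat) (p k : nat) :
  prime p -> (0 < k)%N -> (forall i, (0 < a i)%N) ->
  (p ^ k %| \big[lcmn/1%N]_i a i)%N -> exists i, (p ^ k %| a i)%N.
Proof.
move=> pp k0 a0.
suff [_] : (0 < \big[lcmn/1%N]_i a i)%N /\
  ((p ^ k %| \big[lcmn/1%N]_i a i)%N -> exists i, (p ^ k %| a i)%N) by [].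
elim/big_rec: _ => [|i V _ [V0 IH]].
  split=> // /(dvdn_trans (dvdn_exp k0 (dvdnn p))).
  by rewrite dvdn1 => /eqP p1; move: pp; rewrite p1.
split; first by rewrite lcmn_gt0 a0.
rewrite pfactor_dvdn // ?lcmn_gt0 ?a0 // logn_lcm // leq_max.
by move=> /orP[h|h]; [exists i; rewrite pfactor_dvdn|apply: IH; rewrite pfactor_dvdn].
Qed.

(* In a vanishing signed sum of unit fractions, the largest power of a prime
   dividing some denominator divides at least two of them. *)
Lemma sqr_lcm_dvd_recip_num0 (I : finType) (s : I -> bool) (x : I -> int) :
  (forall i, x i != 0) -> recip_num s x = 0 ->
  ((\big[lcmn/1%N]_i absz (x i)) ^ 2 %| \prod_i absz (x i))%N.
Proof.
move=> x0 num0; have a0 i : (0 < absz (x i))%N by rewrite absz_gt0.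
have P0 : (0 < \prod_i absz (x i))%N by rewrite prodn_gt0.
set V := \big[lcmn/1%N]_i absz (x i).
have V0 : (0 < V)%N by rewrite /V; elim/big_ind: _ => // *; rewrite lcmn_gt0; apply/andP.
apply/dvdn_partP => [|p]; first by rewrite expn_gt0 V0.
rewrite pi_of_exp // => /[dup] pV; rewrite mem_primes => /andP[pp _].
rewrite p_part lognX; set k := logn p V.
have k0 : (0 < k)%N by rewrite logn_gt0.
have [i hi] : exists i, (p ^ k %| absz (x i))%N.
  by apply: pfactor_dvdn_biglcmn => //; exact: pfactor_dvdnn.
have [/existsP[j /andP[ji hj]]|] := boolP [exists j, (j != i) && (p ^ k %| absz (x j))%N].
  rewrite (bigD1 i) //= (bigD1 j) //= mulnA dvdn_mulr //.
  by rewrite mul2n -addnn expnD dvdn_mul.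
(* Otherwise [x i] alone is divisible by [p ^ k]. Its cofactor [Pi i] then has strictly smaller
   [p]-adic valuation than every other cofactor, so the term of [i] cannot cancel against the
   rest. *)
rewrite negb_exists => /forallP nex.
pose Pi i := \prod_(j | j != i) absz (x j).
have Pi0 j : (0 < Pi j)%N by rewrite prodn_gt0.
have PE j : (\prod_i absz (x i) = absz (x j) * Pi j)%N by rewrite (bigD1 j).
have lj j : j != i -> (logn p (Pi i) < logn p (Pi j))%N.
  move=> ji; have : (logn p (absz (x j)) < logn p (absz (x i)))%N.
    apply: (@leq_trans k); last by rewrite -pfactor_dvdn.
    by move: (nex j); rewrite ji /= pfactor_dvdn // -ltnNge.
  have : (logn p (absz (x i) * Pi i) = logn p (absz (x j) * Pi j))%N by rewrite -!PE.
  by rewrite !lognM // => h1 h2; rewrite -(ltn_add2l (logn p (absz (x j)))) -h1 ltn_add2r.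
pose l := logn p (Pi i).
have absP j : absz (\prod_(m | m != j) x m) = Pi j.
  by rewrite /Pi; elim/big_rec2: _ => // m y z _ <-; rewrite abszM.
have : ((p ^ l.+1)%:Z %| (-1) ^+ s i * \prod_(j | j != i) x j)%Z.
  move: num0; rewrite /recip_num (bigD1 i) //= => /eqP; rewrite addr_eq0 => /eqP ->.
  rewrite rpredN; apply: rpred_sum => j ji; apply: dvdz_mull.
  by rewrite dvdzE absP /= pfactor_dvdn // lj.
rewrite dvdzE abszM absP abszX /= exp1n mul1n pfactor_dvdn //.
by rewrite /l ltnn.
Qed.

(** * Divisor and harmonic bounds with real exponents, and the encoding of nonzero integers *)

(** A [k]-th root of the integer bound, with [k] chosen so that [k^-1 <= eta]. *)
Lemma size_divisors_powR (R : realType) (eta : R) : 0 < eta ->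
  exists2 C : R, 0 < C & forall n, (0 < n)%N -> (size (divisors n))%:R <= C * n%:R `^ eta.
Proof.
move=> eta0; pose k := (Num.trunc eta^-1).+1.
have k0 : 0 < k%:R :> R by rewrite ltr0n.
have ke : k%:R^-1 <= eta.
  by rewrite invf_ple ?posrE // ltW // /k truncnS_gt.
have [C C0 hC] := @size_divisors_bound k isT.
exists (C%:R `^ k%:R^-1); first by rewrite powR_gt0 // ltr0n.
move=> n n0; have n1 : 1 <= n%:R :> R by rewrite ler1n.
apply: (@le_trans _ _ ((C * n)%:R `^ k%:R^-1)); last first.
  rewrite natrM powRM ?ler0n // ler_wpM2l ?powR_ge0 //; exact: ler_powR.
have e (t : R) : 0 <= t -> (t ^+ k) `^ k%:R^-1 = t.
  by move=> t0; rewrite -powR_mulrn // -powRrM mulfV ?powRr1 // lt0r_neq0.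
rewrite -[leLHS]e ?ler0n // -natrX.
by apply: ge0_ler_powR; rewrite ?nnegrE ?ler0n ?invr_ge0 ?(ltW k0) // ler_nat hC.
Qed.

Lemma harmonic_sum_le_ln (R : realType) (K : nat) :
  \sum_(i < K.+1) (i.+1%:R)^-1 <= 1 + ln K.+1%:R :> R.
Proof.
elim: K => [|K IH]; first by rewrite big_ord1 invr1 ln1 addr0.
rewrite big_ord_recr /=; apply: (le_trans (lerD IH (lexx _))).
rewrite -addrA lerD2l.
have a0 : 0 < K.+1%:R :> R by rewrite ltr0n.
have b0 : 0 < K.+2%:R :> R by rewrite ltr0n.
rewrite -lerBrDl -opprB lerNr -ln_div ?posrE //.
have -> : K.+1%:R / K.+2%:R = 1 + - (K.+2%:R)^-1 :> R.
  by rewrite -[X in X / _ = _](addrK 1 K.+1%:R) natr1 mulrBl divff ?mul1r // lt0r_neq0.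
apply: le_ln1Dx; rewrite ltrN2 invf_lt1 // ltr1n //.
Qed.

(** The logarithm is absorbed through [eta * ln t = ln (t]^ eta) < t [^ eta]. *)
Lemma harmonic_sum_powR (R : realType) (eta : R) (K : nat) : 0 < eta -> (0 < K)%N ->
  \sum_(i < K) (i.+1%:R)^-1 <= (1 + eta^-1) * K%:R `^ eta.
Proof.
case: K => // K eta0 _; apply: (le_trans (harmonic_sum_le_ln _ _)).
have K1 : 1 <= K.+1%:R :> R by rewrite ler1n.
have h1 : 1 <= K.+1%:R `^ eta by rewrite -[leLHS](powRr0 K.+1%:R) ler_powR // ltW.
by rewrite mulrDl mul1r lerD // ler_pdivlMl // -ln_powR ltW // ln_sublinear // (lt_le_trans _ h1).
Qed.

(* [bool * 'I_K] encodes the nonzero integers of absolute value at most [K]. *)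
Definition signed_int (K : nat) (d : bool * 'I_K) : int := (-1) ^+ d.1 * (d.2.+1)%:Z.

Lemma absz_signed_int (K : nat) (d : bool * 'I_K) : absz (signed_int d) = d.2.+1.
Proof. by rewrite /signed_int abszM abszX exp1n mul1n. Qed.

Lemma signed_int_neq0 (K : nat) (d : bool * 'I_K) : signed_int d != 0.
Proof. by rewrite -absz_eq0 absz_signed_int. Qed.

Lemma big_bool_ord_sum (R : nmodType) (K : nat) (F : nat -> R) :
  \sum_(d : bool * 'I_K) F d.2 = (\sum_(i < K) F i) *+ 2.
Proof.
rewrite -(pair_bigA _ (fun (b : bool) (i : 'I_K) => F i)) /=.
by rewrite big_bool /= mulr2n.
Qed.

Lemma card_divisors_signed (K V : nat) : (0 < V)%N ->
  (#|[pred d : bool * 'I_K | d.2.+1 %| V]| <= 2 * size (divisors V))%N.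
Proof.
move=> V0; rewrite mul2n -addnn -sum1_card.
rewrite big_mkcond (big_bool_ord_sum K (fun i => if (i.+1 %| V)%N then 1%N else 0%N)).
rewrite mulr2n -big_mkcond sum1_card.
suff h : (#|[pred i : 'I_K | i.+1 %| V]| <= size (divisors V))%N by exact: leq_add.
rewrite cardE -(size_map (fun i : 'I_K => i.+1)); apply: uniq_leq_size.
  by rewrite map_inj_uniq ?enum_uniq // => i j [] /val_inj.
by move=> d /mapP[i hi ->]; move: hi; rewrite mem_enum inE dvdn_divisors.
Qed.

(** * The diagonal and off-diagonal sums and their bounds *)

Section Sums.
Variables (R : realType) (I : finType) (s : I -> bool).

Notation num f := (recip_num s (fun i => signed_int (f i))).

(** The weight comes from [|F(x)| <= sqrt (N q / |x|)], the geometric mean of the two bounds on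
    [F]. *)
Definition diagonal_sum (K : nat) : R :=
  \sum_(f : {ffun I -> bool * 'I_K} | num f == 0)
    (Num.sqrt (\prod_i (absz (signed_int (f i)))%:R))^-1.

(** Here the weight comes from [|F(x)| <= q / |x|] alone. *)
Definition offdiagonal_sum (K q : nat) : R :=
  \sum_(f : {ffun I -> bool * 'I_K} | (num f != 0) && (q %| absz (num f))%N)
    \prod_i (absz (signed_int (f i)))%:R^-1.

End Sums.

Section Counting.
Variables (R : realType) (I : finType).

Notation tuples K := {ffun I -> bool * 'I_K}.
Notation num s f := (recip_num s (fun i => signed_int (f i))).

(** Solutions are grouped by the lcm [V] of their entries. The weight is at most [1 / V], and the
    entries are signed divisors of [V], so the divisor bound leaves a harmonic sum over [V]. *)
Lemma diagonal_sum_bound (eta : R) : 0 < eta ->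
  exists2 C : R, 0 < C & forall (K : nat) (s : I -> bool), (0 < K)%N ->
    diagonal_sum R s K <= C * K%:R `^ eta.
Proof.
move=> eta0; set n := #|I|.
have m0 : 0 < (n * n + n).+1%:R :> R by rewrite ltr0n.
(* The range [X = K ^ n] enters to the power [h] a total of [n + 1] times, [n] from the divisor
   bound and one from the harmonic sum: the exponent of [K] is [h * (n * n + n) <= eta]. *)
pose h := eta / (n * n + n).+1%:R; have h0 : 0 < h by rewrite divr_gt0.
have [C C0 hC] := size_divisors_powR h0.
have hi0 : 0 < 1 + h^-1 by rewrite addr_gt0 // invr_gt0.
exists ((2 * C) ^+ n * (1 + h^-1)); first by rewrite mulr_gt0 // exprn_gt0 // mulr_gt0.
move=> K s K0; rewrite /diagonal_sum; pose X := (K ^ n)%N.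
have X0 : (0 < X)%N by rewrite expn_gt0 K0.
pose ind (V : nat) (d : bool * 'I_K) : R := (d.2.+1 %| V)%N%:R.
have ind0 V d : 0 <= ind V d by exact: ler0n.
have term0 v (f : tuples K) : 0 <= v.+1%:R^-1 * \prod_i ind v.+1 (f i).
  by rewrite mulr_ge0 ?invr_ge0 ?ler0n // prodr_ge0.
have le1 (f : tuples K) : num s f == 0 ->
    (Num.sqrt (\prod_i (absz (signed_int (f i)))%:R))^-1 <=
    \sum_(v < X) (v.+1%:R)^-1 * \prod_i ind v.+1 (f i).
  move=> /eqP nf0; set V := \big[lcmn/1%N]_i absz (signed_int (f i)).
  have a0 i : (0 < absz (signed_int (f i)))%N by rewrite absz_signed_int.
  have P0 : (0 < \prod_i absz (signed_int (f i)))%N by rewrite prodn_gt0.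
  have V2 : (V ^ 2 <= \prod_i absz (signed_int (f i)))%N.
    by apply: dvdn_leq => //; apply: sqr_lcm_dvd_recip_num0 nf0 => i; exact: signed_int_neq0.
  have V0 : (0 < V)%N by rewrite /V; elim/big_ind: _ => // *; rewrite lcmn_gt0; apply/andP.
  have dV i : (absz (signed_int (f i)) %| V)%N by rewrite /V (bigD1 i) //= dvdn_lcml.
  (* The index [v] stands for the lcm [v + 1], and [V <= V ^ 2 <= K ^ n]. *)
  have VX : (V.-1 < X)%N.
    rewrite prednK //; apply: (@leq_trans (V ^ 2)); first by rewrite expnS expn1 leq_pmulr.
    apply: (leq_trans V2); rewrite /X -prod_nat_const; apply: leq_prod => i _.
    by rewrite absz_signed_int.
  rewrite (bigD1 (Ordinal VX)) //= prednK // [X in _ * X]big1 ?mulr1; last first.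
    by move=> i _; rewrite /ind; move: (dV i); rewrite absz_signed_int => ->.
  apply: (@le_trans _ _ V%:R^-1); last first.
    by rewrite lerDl sumr_ge0.
  rewrite lef_pV2 ?posrE ?sqrtr_gt0 ?ltr0n //; last by rewrite -natr_prod ltr0n.
  by rewrite -[leLHS](ger0_norm (ler0n R V)) -sqrtr_sqr ler_wsqrtr // -natr_prod -natrX ler_nat.
apply: (le_trans (ler_sum _ le1)).
apply: (@le_trans _ _ (\sum_(f : tuples K) \sum_(v < X) (v.+1%:R)^-1 * \prod_i ind v.+1 (f i))).
  by rewrite big_mkcond; apply: ler_sum => f _; case: ifP => // _; rewrite sumr_ge0.
rewrite exchange_big /=.
have le2 (v : 'I_X) : true -> \sum_(f : tuples K) (v.+1%:R)^-1 * \prod_i ind v.+1 (f i) <=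
    (v.+1%:R)^-1 * (2 * C * X%:R `^ h) ^+ n.
  move=> _; rewrite -mulr_sumr ler_wpM2l ?invr_ge0 ?ler0n //.
  (* The sum over tuples factors into the [n]-th power of the number of signed divisors of
     [v + 1]. *)
  rewrite -(bigA_distr_bigA (fun (_ : I) d => ind v.+1 d)) prodr_const -/n.
  apply: lerXn2r; rewrite ?nnegrE ?sumr_ge0 ?mulr_ge0 ?powR_ge0 ?(ltW C0) //.
  rewrite -natr_sum -big_mkcond sum1_card.
  apply: (@le_trans _ _ (2 * size (divisors v.+1))%:R).
    by rewrite ler_nat card_divisors_signed.
  rewrite natrM -mulrA ler_wpM2l //; apply: (le_trans (hC _ _)) => //.
  rewrite ler_wpM2l ?(ltW C0) //; apply: ge0_ler_powR; rewrite ?nnegrE ?(ltW h0) ?ler_nat //.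
apply: (le_trans (ler_sum _ le2)).
rewrite -mulr_suml [X in X <= _]mulrC -[X in _ <= X]mulrA exprMn -mulrA.
rewrite ler_wpM2l ?exprn_ge0 ?mulr_ge0 ?(ltW C0) //.
apply: (@le_trans _ _ ((X%:R `^ h) ^+ n * ((1 + h^-1) * X%:R `^ h))).
  by rewrite ler_wpM2l ?exprn_ge0 ?powR_ge0 // harmonic_sum_powR.
rewrite mulrCA ler_wpM2l ?(ltW hi0) // -exprSr.
rewrite /X natrX -[K%:R ^+ n]powR_mulrn ?ler0n // -powRrM -powR_mulrn ?powR_ge0 // -powRrM.
apply: ler_powR; first by rewrite ler1n.
rewrite mulrAC -natrM /h mulrCA -[leRHS]mulr1 ler_pM2l // ler_pdivrMr // mul1r ler_nat.
by rewrite mulnS addnC.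
Qed.

Lemma recip_num_bound (K : nat) (s : I -> bool) (f : tuples K) : (0 < K)%N ->
  (absz (num s f) <= #|I| * K ^ #|I|)%N.
Proof.
move=> K0; rewrite -lez_nat abszE; apply: le_trans (ler_norm_sum _ _ _) _.
rewrite -sum_nat_const -natz natr_sum; apply: ler_sum => i _.
rewrite normrM normrX normrN1 expr1n mul1r normr_prod.
rewrite -prod_nat_const natr_prod big_mkcond /=; apply: ler_prod => j _.
rewrite -abszE absz_signed_int natz; case: ifP => _ /=; last by rewrite lez_nat K0.
by rewrite lez_nat ltn_ord.
Qed.

(** After exchanging the sums, a tuple is counted once for each [q] in [E] dividing its nonzero
    numerator, hence at most as often as that numerator has divisors. The weights summed over all
    tuples are the [n]-th power of a harmonic sum. *)
Lemma offdiagonal_sum_bound (eta : R) : 0 < eta ->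
  exists2 C : R, 0 < C & forall (K : nat) (s : I -> bool) (E : seq nat), (0 < K)%N -> uniq E ->
    \sum_(q <- E) offdiagonal_sum R s K q <= C * K%:R `^ eta.
Proof.
move=> eta0; set n := #|I|.
have m0 : 0 < (n + n).+1%:R :> R by rewrite ltr0n.
(* The divisor bound for a numerator of size at most [n * K ^ n] and the [n] harmonic sums each give
   [K] to the power [n * h]. *)
pose h := eta / (n + n).+1%:R; have h0 : 0 < h by rewrite divr_gt0.
have [C C0 hC] := size_divisors_powR h0.
have hi0 : 0 < 1 + h^-1 by rewrite addr_gt0 // invr_gt0.
have n0 : 0 < n.+1%:R `^ h by rewrite powR_gt0 // ltr0n.
exists (C * n.+1%:R `^ h * (2 * (1 + h^-1)) ^+ n).
  by rewrite mulr_gt0 // ?exprn_gt0 // mulr_gt0.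
move=> K s E K0 uE.
pose w (f : tuples K) : R := \prod_i (absz (signed_int (f i)))%:R^-1.
have w0 f : 0 <= w f by rewrite prodr_ge0 // => i _; rewrite invr_ge0 ler0n.
pose T := C * (n.+1 * K ^ n)%:R `^ h.
have T0 : 0 <= T by rewrite mulr_ge0 ?powR_ge0 // ltW.
under eq_bigr do rewrite /offdiagonal_sum big_mkcond.
rewrite exchange_big /=.
have le1 (f : tuples K) : true -> \sum_(q <- E)
   (if (num s f != 0) && (q %| absz (num s f))%N then w f else 0) <= T * w f.
  move=> _; have [->|nf0] := eqVneq (num s f) 0; first by rewrite big1 //= mulr_ge0.
  rewrite -big_mkcond big_const_seq iter_addr_0 -[X in X <= _]mulr_natl ler_wpM2r //.
  have nf1 : (0 < absz (num s f))%N by rewrite absz_gt0.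
  apply: (@le_trans _ _ (size (divisors (absz (num s f))))%:R).
    rewrite ler_nat -size_filter; apply: uniq_leq_size; first exact: filter_uniq.
    by move=> q; rewrite mem_filter -dvdn_divisors // => /andP[].
  apply: (le_trans (hC _ nf1)); rewrite ler_wpM2l ?(ltW C0) //.
  apply: ge0_ler_powR; rewrite ?nnegrE ?(ltW h0) // ler_nat.
  by apply: (leq_trans (recip_num_bound _ _ K0)); rewrite leq_mul2r leqnSn orbT.
apply: (le_trans (ler_sum _ le1)).
rewrite -mulr_sumr -(bigA_distr_bigA (fun (_ : I) d => (absz (signed_int d))%:R^-1)).
under eq_bigr do under eq_bigr do rewrite absz_signed_int.
rewrite prodr_const -/n (big_bool_ord_sum _ (fun i => (i.+1%:R)^-1 : R)).
apply: (@le_trans _ _ (T * (2 * ((1 + h^-1) * K%:R `^ h)) ^+ n)).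
  rewrite ler_wpM2l // -[X in X ^+ n <= _]mulr_natl; apply: lerXn2r.
  - by rewrite nnegrE mulr_ge0 // sumr_ge0 // => i _; rewrite invr_ge0 ler0n.
  - by rewrite nnegrE !mulr_ge0 ?powR_ge0 ?(ltW hi0).
  - by rewrite ler_wpM2l // harmonic_sum_powR.
rewrite /T natrM powRM ?ler0n // !exprMn -!mulrA ler_wpM2l ?(ltW C0) //.
rewrite ler_wpM2l ?(ltW n0) // [leLHS]mulrCA ler_wpM2l ?exprn_ge0 // [leLHS]mulrCA.
rewrite ler_wpM2l ?exprn_ge0 ?(ltW hi0) //.
rewrite natrX -[K%:R ^+ n]powR_mulrn ?ler0n // -powRrM -[_ ^+ n]powR_mulrn ?powR_ge0 // -powRrM.
rewrite -powRD; last by rewrite pnatr_eq0 -lt0n K0 implybT.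
apply: ler_powR; first by rewrite ler1n.
rewrite [h * _]mulrC -mulrDl -natrD /h mulrCA -[leRHS]mulr1 ler_pM2l //.
by rewrite ler_pdivrMr // mul1r ler_nat leqnSn.
Qed.
End Counting.

(** * Additive characters modulo [q] *)

Lemma intr_Zp_eq0 (q : nat) (z : int) : (1 < q)%N ->
  (z%:~R == 0 :> 'Z_q) = (q %| absz z)%N.
Proof.
move=> q1; have nat0 (n : nat) : (n%:R == 0 :> 'Z_q) = (q %| n)%N.
  by rewrite -val_eqE /= val_Zp_nat.
case: z => n; first by rewrite -pmulrn nat0.
by rewrite NegzE mulrNz oppr_eq0 -pmulrn nat0 abszN.
Qed.

Definition centered_rep (q : nat) (a : 'Z_q) : int :=
  if (2 * a <= q)%N then (nat_of_ord a)%:Z else (nat_of_ord a)%:Z - q%:Z.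

Lemma centered_repE (q : nat) (q1 : (1 < q)%N) (a : 'Z_q) : (centered_rep a)%:~R = a.
Proof.
have qz : (q%:Z)%:~R = 0 :> 'Z_q by apply/eqP; rewrite intr_Zp_eq0.
by rewrite /centered_rep; case: ifP => _; rewrite ?rmorphB /= ?qz ?subr0 -pmulrn natr_Zp.
Qed.

Lemma centered_rep_le (q : nat) (q1 : (1 < q)%N) (a : 'Z_q) : (2 * absz (centered_rep a) <= q)%N.
Proof.
have aq : (a < q)%N by rewrite -{2}(Zp_cast q1).
rewrite /centered_rep; case: (leqP (2 * a) q) => // h.
rewrite -opprB abszN subzn ?absz_nat; last exact: ltnW.
lia.
Qed.

(** By the mean value theorem, [sin t = 2 sin (t/2) cos (t/2) = t * cos c * cos (t/2)] with [c]
    between [0] and [t/2 <= pi/4], where both cosines have square at least [1/2]. *)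
Lemma half_le_sin (R : realType) (t : R) : 0 <= t <= pi / 2 -> t / 2 <= sin t.
Proof.
move=> /andP[t0 tpi].
have cos_sq (u : R) : 0 <= u <= pi / 4 -> 0 <= cos u /\ 2^-1 <= cos u ^+ 2.
  move=> /andP[u0 u4]; have p0 := pi_gt0 R.
  split; first by apply: cos_ge0_pihalf; apply/andP; split; lra.
  have : 0 <= cos (u *+ 2) by apply: cos_ge0_pihalf; rewrite [u *+ 2]mulr2n; apply/andP; split; lra.
  by rewrite cos_mulr2n [_ ^+ 2 *+ 2]mulr2n; lra.
have t20 : 0 <= t / 2 by lra.
have [|c + hc] := @MVT_segment R sin cos 0 (t / 2) t20 (fun x _ => is_derive_sin x).
  exact/continuous_subspaceT/continuous_sin.
rewrite in_itv /= => /andP[c0 ct].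
have [|c1 c2] := @cos_sq c; first by apply/andP; split; lra.
have [|u1 u2] := @cos_sq (t / 2); first by apply/andP; split; lra.
have {1}-> : sin t = sin (t / 2 *+ 2) by rewrite [t / 2 *+ 2]mulr2n -splitr.
move: hc; rewrite sin_mulr2n sin0 !subr0 => ->.
have : 2^-1 <= cos c * cos (t / 2).
  rewrite -(@ler_pXn2r _ 2) ?nnegrE ?mulr_ge0 ?invr_ge0 // exprMn; nra.
move: (cos c) (cos (t / 2)) => x y; nra.
Qed.

Section AdditiveCharacter.
Variables (R : realType) (q : nat).
Hypothesis q1 : (1 < q)%N.

Let q0 : (q%:R : R) != 0. Proof. by rewrite pnatr_eq0 -lt0n ltnW. Qed.

Lemma e_modD (z w : int) : e_mod R q (z + w) = e_mod R q z * e_mod R q w.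
Proof.
by rewrite /e_mod rmorphD /= mulrDr mulrDl cosD sinD; simpc; rewrite [X in _ +i* X]addrC.
Qed.

Lemma e_mod0 : e_mod R q 0 = 1.
Proof. by rewrite /e_mod mulr0 mul0r cos0 sin0. Qed.

Lemma e_modMn (z : int) (n : nat) : e_mod R q (z *+ n) = e_mod R q z ^+ n.
Proof. by elim: n => [|n IH]; rewrite ?mulr0n ?e_mod0 // mulrS exprS e_modD IH. Qed.

Lemma e_modN (z : int) : e_mod R q (- z) = (e_mod R q z)^*.
Proof. by rewrite /e_mod mulrNz mulrN mulNr cosN sinN. Qed.

Lemma e_mod_dvd (z : int) : (q %| absz z)%N -> e_mod R q z = 1.
Proof.
have main n : e_mod R q (q%:Z *+ n) = 1.
  rewrite e_modMn /e_mod -pmulrn mulfK // mulrC mulr_natr cos2pi sin2pi.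
  by rewrite complexr0 expr1n.
case/dvdnP => n; case: z => m /= h.
  by rewrite h -(main n) -mulr_natr natz mulrC.
rewrite NegzE h e_modN -[RHS]conjc1 -(main n) -mulr_natr natz mulrC.
by [].
Qed.

Lemma norm_e_mod (z : int) : `|e_mod R q z| = 1.
Proof. by rewrite normc_def /= cos2Dsin2 sqrtr1. Qed.

Definition zp_char (a : 'Z_q) : R[i] := e_mod R q (nat_of_ord a)%:Z.

Lemma zp_char_int (z : int) : zp_char z%:~R = e_mod R q z.
Proof.
rewrite /zp_char -[LHS]mulr1 -(@e_mod_dvd (z - (nat_of_ord (z%:~R : 'Z_q))%:Z)).
  by rewrite -e_modD addrC subrK.
by rewrite -intr_Zp_eq0 // rmorphB /= -pmulrn natr_Zp subrr.
Qed.

Lemma Zp_intr_surj (a : 'Z_q) : exists z : int, a = z%:~R.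
Proof. by exists (nat_of_ord a)%:Z; rewrite -pmulrn natr_Zp. Qed.

Lemma zp_charD (a b : 'Z_q) : zp_char (a + b) = zp_char a * zp_char b.
Proof.
have [z ->] := Zp_intr_surj a; have [w ->] := Zp_intr_surj b.
by rewrite -rmorphD !zp_char_int e_modD.
Qed.

Lemma zp_char0 : zp_char 0 = 1.
Proof. exact: e_mod0. Qed.

Lemma zp_charN (a : 'Z_q) : zp_char (- a) = (zp_char a)^*.
Proof. by have [z ->] := Zp_intr_surj a; rewrite -rmorphN !zp_char_int e_modN. Qed.

Lemma zp_char_sum (I : finType) (P : pred I) (F : I -> 'Z_q) :
  zp_char (\sum_(i | P i) F i) = \prod_(i | P i) zp_char (F i).
Proof. exact: (big_morph zp_char zp_charD zp_char0). Qed.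

Lemma norm_zp_char (a : 'Z_q) : `|zp_char a| = 1.
Proof. exact: norm_e_mod. Qed.

(** With [t = pi |z| / q <= pi / 2], the left-out chord length is [2 sin t >= t], and [pi >= 2]. *)
Lemma e_mod_sub1_ge (z : int) : (2 * absz z <= q)%N ->
  (2 * (absz z)%:R / q%:R)%:C <= `|e_mod R q z - 1|.
Proof.
move=> zq; have qp : 0 < q%:R :> R by rewrite ltr0n ltnW.
set t := pi * (absz z)%:R / q%:R : R.
have zq' : (absz z)%:R / q%:R <= 2^-1 :> R.
  by rewrite ler_pdivrMr // ler_pdivlMl // -natrM ler_nat.
have t0 : 0 <= t by rewrite /t !mulr_ge0 ?pi_ge0 ?invr_ge0.
have tpi : t <= pi / 2 by rewrite /t -mulrA ler_wpM2l ?pi_ge0.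
have -> : `|e_mod R q z - 1| = (2 * sin t)%:C.
  have -> : `|e_mod R q z - 1| = `|e_mod R q (absz z)%:Z - 1|.
    case: z {zq t zq' t0 tpi} => n //; rewrite NegzE abszN e_modN -[in LHS]conjc1 -rmorphB.
    exact: normcJ.
  rewrite normc_def /= /e_mod /= subr0 -pmulrn.
  have -> : 2 * pi * (absz z)%:R / q%:R = t *+ 2 by rewrite -[t *+ 2]mulr_natl /t !mulrA.
  rewrite cos_mulr2n sin_mulr2n; congr (_%:C).
  rewrite -[RHS]ger0_norm ?mulr_ge0 ?sin_ge0_pi //; last first.
    by rewrite t0 /=; have := pi_gt0 R; lra.
  rewrite -sqrtr_sqr; congr Num.sqrt.
  have := sin2cos2 t; move: (sin t) (cos t) => x y; nra.
rewrite lecR -mulrA ler_pM2l //.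
apply: le_trans (half_le_sin _); last by rewrite t0.
have := pi_ge2 R; rewrite /t ler_pdivlMr // -mulrA [_ * 2]mulrC => p2.
by rewrite ler_wpM2r // mulr_ge0 // ?invr_ge0.
Qed.

Lemma zp_char_eq1 (a : 'Z_q) : zp_char a = 1 -> a = 0.
Proof.
rewrite -(centered_repE q1 a) zp_char_int => h.
have := e_mod_sub1_ge (centered_rep_le q1 a); rewrite h subrr normr0 lecR => le0.
have : (absz (centered_rep a))%:R <= 0 :> R.
  have q_gt0 : 0 < q%:R :> R by rewrite ltr0n ltnW.
  by move: le0; rewrite ler_pdivrMr // mul0r pmulr_rle0.
by rewrite lern0 absz_eq0 => /eqP ->.
Qed.

Lemma zp_char_orthogonality (a : 'Z_q) :
  \sum_(m : 'Z_q) zp_char (m * a) = if a == 0 then q%:R else 0.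
Proof.
have [->|a0] := eqVneq a 0.
  under eq_bigr do rewrite mulr0 zp_char0.
  by rewrite sumr_const card_ord Zp_cast.
set S := \sum_m _; have hS : zp_char a * S = S.
  rewrite /S [in RHS](reindex_inj (addIr 1)) mulr_sumr /=; apply: eq_bigr => m _.
  by rewrite mulrDl mul1r zp_charD mulrC.
apply/eqP; have /eqP : (zp_char a - 1) * S = 0 by rewrite mulrBl hS mul1r subrr.
rewrite mulf_eq0 => /orP[|//]; rewrite subr_eq0 => /eqP /zp_char_eq1 a0'.
by rewrite a0' eqxx in a0.
Qed.

(** Multiplying the geometric sum by [zp_char a - 1] telescopes it. Stating the second bound as a
    product avoids dividing by the representative of [a]. *)
Lemma zp_char_geometric_bound (a : 'Z_q) (L N : nat) :
  `|\sum_(L.+1 <= n < (L + N).+1) zp_char (n%:R * a)| <= N%:R /\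
  `|\sum_(L.+1 <= n < (L + N).+1) zp_char (n%:R * a)| * (absz (centered_rep a))%:R <= q%:R.
Proof.
set S := \sum_(_ <= n < _) _; split.
  apply: le_trans (ler_norm_sum _ _ _) _; under eq_bigr do rewrite norm_zp_char.
  by rewrite big_const_nat iter_addr_0 subSS addKn.
have tele : S * (zp_char a - 1) = zp_char ((L + N).+1%:R * a) - zp_char (L.+1%:R * a).
  rewrite -(telescope_sumr (fun n => zp_char (n%:R * a))) ?ltnS ?leq_addr // mulr_suml.
  apply: eq_bigr => n _.
  by rewrite -[n.+1%:R]natr1 mulrDl mul1r zp_charD mulrBr mulr1.
have S2 : `|S| * `|zp_char a - 1| <= 2.
  by rewrite -normrM tele; apply: le_trans (ler_normB _ _) _; rewrite !norm_zp_char.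
have qp : 0 < q%:R :> R[i] by rewrite ltr0n ltnW.
have := e_mod_sub1_ge (centered_rep_le q1 a); rewrite -zp_char_int (centered_repE q1) => lb.
have {S2 lb} : `|S| * (2 * (absz (centered_rep a))%:R / q%:R) <= 2.
  apply: le_trans S2; rewrite ler_wpM2l //; apply: le_trans lb.
  by rewrite rmorphM /= fmorphV rmorphM /= !rmorph_nat.
by rewrite !mulrA ler_pdivrMr // mulrAC [_ * 2]mulrC ler_pM2l // ltr0n.
Qed.

(** The power [|z| ^ (2r)] is a product over [bool * 'I_r], the boolean marking the conjugated
    factors; conjugation turns into the sign in the congruence. Expanding and summing over [m]
    leaves the solutions by orthogonality. *)
Lemma zp_char_moment (r : nat) (F : {unit 'Z_q} -> R[i]) :
  \sum_(m : 'Z_q) `|\sum_x F x * zp_char (m * (val x)^-1)| ^+ (2 * r) <=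
  q%:R * \sum_(f : {ffun bool * 'I_r -> {unit 'Z_q}} |
                 \sum_(i : bool * 'I_r) (-1) ^+ i.1 * (val (f i))^-1 == 0 :> 'Z_q)
    \prod_i `|F (f i)|.
Proof.
pose cj (b : bool) (z : R[i]) := if b then z^* else z.
have cjM b : {morph cj b : y z / y * z} by case: b => y z //=; exact: rmorphM.
have cj_norm b z : `|cj b z| = `|z| by case: b; rewrite //= normcJ.
have cj_char b a : cj b (zp_char a) = zp_char ((-1) ^+ b * a).
  by case: b; rewrite /= ?mulN1r ?mul1r // zp_charN.
have cj_sum b (T : finType) (G : T -> R[i]) : cj b (\sum_x G x) = \sum_x cj b (G x).
  by case: b; rewrite //= rmorph_sum.
pose sgsum (f : {ffun bool * 'I_r -> {unit 'Z_q}}) : 'Z_q :=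
  \sum_(i : bool * 'I_r) (-1) ^+ i.1 * (val (f i))^-1.
have powE (z : R[i]) : `|z| ^+ (2 * r) = \prod_(i : bool * 'I_r) cj i.1 z.
  rewrite exprM sqr_normc -(pair_bigA _ (fun b (i : 'I_r) => cj b z)) /= big_bool /=.
  by rewrite !prodr_const card_ord -exprMn mulrC.
have expand (m : 'Z_q) : `|\sum_x F x * zp_char (m * (val x)^-1)| ^+ (2 * r) =
    \sum_(f : {ffun bool * 'I_r -> {unit 'Z_q}})
      (\prod_i cj i.1 (F (f i))) * zp_char (m * sgsum f).
  rewrite powE; under eq_bigr do rewrite cj_sum.
  rewrite (bigA_distr_bigA (fun (i : bool * 'I_r) x => cj i.1 (F x * zp_char (m * (val x)^-1)))).
  apply: eq_bigr => f _; rewrite /sgsum mulr_sumr zp_char_sum -big_split /=.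
  by apply: eq_bigr => i _; rewrite cjM cj_char mulrCA.
have S0 : 0 <= \sum_(m : 'Z_q) `|\sum_x F x * zp_char (m * (val x)^-1)| ^+ (2 * r).
  by apply: sumr_ge0 => m _; rewrite exprn_ge0.
rewrite -(ger0_norm S0) (eq_bigr _ (fun m _ => expand m)) exchange_big /=.
under eq_bigr do rewrite -mulr_sumr zp_char_orthogonality.
apply: le_trans (ler_norm_sum _ _ _) _; rewrite mulr_sumr [leRHS]big_mkcond /=.
apply: ler_sum => f _; rewrite normrM normr_prod /sgsum.
case: ifP => _; last by rewrite normr0 mulr0.
by rewrite normr_nat mulrC; under eq_bigr do rewrite cj_norm.
Qed.

End AdditiveCharacter.

(** * Hoelder's inequality for finite sums *)

Lemma tangent_line_exprS (R : realFieldType) (r : nat) (x y : R) : 0 <= x -> 0 <= y ->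
  y ^+ r.+1 + r.+1%:R * y ^+ r * (x - y) <= x ^+ r.+1.
Proof.
move=> x0 y0; elim: r => [|r IH]; first by rewrite expr0 !expr1; lra.
have := ler_wpM2l x0 IH; rewrite -exprS; apply: le_trans.
(* Multiplying the induction hypothesis by [x] overshoots the next tangent line by exactly this
   nonnegative square term. *)
rewrite -subr_ge0 [leRHS](_ : _ = r.+1%:R * y ^+ r * (x - y) ^+ 2).
  by rewrite mulr_ge0 ?sqr_ge0 ?mulr_ge0 ?exprn_ge0.
by rewrite -!natr1 !exprS; ring.
Qed.

Section FiniteHoelder.
Variables (R : realFieldType) (T : finType).

(** Jensen's inequality: sum the tangent line inequality at the weighted mean [y = B / A], where the
    linear terms cancel. *)
Lemma weighted_power_mean (r : nat) (a g : T -> R) :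
  (forall t, 0 <= a t) -> (forall t, 0 <= g t) ->
  (\sum_t a t * g t) ^+ r.+1 <= (\sum_t a t) ^+ r * \sum_t a t * g t ^+ r.+1.
Proof.
move=> a0 g0; set A := \sum_t a t; set B := \sum_t a t * g t.
have A0 : 0 <= A by exact: sumr_ge0.
have [A00|An0] := eqVneq A 0.
  have at0 t : a t = 0 by have /psumr_eq0P := A00; exact.
  by rewrite /B big1 ?expr0n ?mulr_ge0 ?exprn_ge0 ?sumr_ge0 // => t _; rewrite at0 mul0r.
have B0 : 0 <= B by apply: sumr_ge0 => t _; rewrite mulr_ge0.
set y := B / A; have y0 : 0 <= y by rewrite divr_ge0.
have BE : B = A * y by rewrite mulrC divfK.
rewrite {1}BE exprMn exprSr -mulrA ler_wpM2l ?exprn_ge0 //.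
apply: (@le_trans _ _ (\sum_t a t * (y ^+ r.+1 + r.+1%:R * y ^+ r * (g t - y)))); last first.
  by apply: ler_sum => t _; rewrite ler_wpM2l // tangent_line_exprS.
under eq_bigr do rewrite mulrDr mulrCA mulrBr.
rewrite big_split /= -mulr_suml -mulr_sumr sumrB -mulr_suml -/A -/B BE.
by rewrite [A * y]mulrC subrr mulr0 addr0 mulrC.
Qed.

Lemma sum_CauchySchwarz (a b : T -> R) :
  (\sum_t a t * b t) ^+ 2 <= (\sum_t a t ^+ 2) * \sum_t b t ^+ 2.
Proof.
set A := \sum_t a t ^+ 2; set B := \sum_t a t * b t; set D := \sum_t b t ^+ 2.
have A0 : 0 <= A by apply: sumr_ge0 => t _; exact: sqr_ge0.
have [A00|An0] := eqVneq A 0.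
  have at0 t : a t = 0.
    have : a t ^+ 2 = 0 by have /psumr_eq0P := A00; apply=> // i _; exact: sqr_ge0.
    by move=> /eqP; rewrite sqrf_eq0 => /eqP.
  by rewrite A00 /B big1 ?expr0n ?mul0r // => t _; rewrite at0 mul0r.
have : 0 <= \sum_t (A * b t - B * a t) ^+ 2 by apply: sumr_ge0 => t _; exact: sqr_ge0.
have -> : \sum_t (A * b t - B * a t) ^+ 2 = A * (A * D - B ^+ 2).
  transitivity (\sum_t (A ^+ 2 * b t ^+ 2 - (2 * A * B) * (a t * b t) + B ^+ 2 * a t ^+ 2)).
    by apply: eq_bigr => t _; ring.
  rewrite big_split /= sumrB -!mulr_sumr -/A -/B -/D; ring.
by rewrite pmulr_rge0 ?subr_ge0 // lt0r An0.
Qed.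

(** Square the power mean inequality, then separate [a] from [g ^+ r.+1] by Cauchy-Schwarz. *)
Lemma sum_hoelder_even (r : nat) (a g : T -> R) :
  (forall t, 0 <= a t) -> (forall t, 0 <= g t) ->
  (\sum_t a t * g t) ^+ (2 * r.+1) <=
  (\sum_t a t) ^+ (2 * r) * (\sum_t a t ^+ 2) * \sum_t g t ^+ (2 * r.+1).
Proof.
move=> a0 g0.
have s0 : 0 <= \sum_t a t * g t by apply: sumr_ge0 => t _; rewrite mulr_ge0.
have t0 : 0 <= \sum_t a t * g t ^+ r.+1.
  by apply: sumr_ge0 => t _; rewrite mulr_ge0 ?exprn_ge0.
rewrite mulnC exprM.
apply: (@le_trans _ _ (((\sum_t a t) ^+ r * \sum_t a t * g t ^+ r.+1) ^+ 2)).
  apply: lerXn2r; last exact: weighted_power_mean.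
    by rewrite nnegrE exprn_ge0.
  by rewrite nnegrE mulr_ge0 // exprn_ge0 // sumr_ge0.
rewrite exprMn -exprM -mulrA [(r * 2)%N]mulnC ler_wpM2l ?exprn_ge0 ?sumr_ge0 //.
apply: le_trans (sum_CauchySchwarz _ _) _.
by under [X in _ * X]eq_bigr do rewrite -exprM.
Qed.

End FiniteHoelder.

Lemma sum_hoelder_powR (R : realType) (T : finType) (r : nat) (a g : T -> R) (M : R) :
  (0 < r)%N -> (forall t, 0 <= a t) -> (forall t, 0 <= g t) -> 0 <= M ->
  \sum_t g t ^+ (2 * r) <= M ^+ (2 * r) ->
  \sum_t a t * g t <=
  (\sum_t a t) `^ (1 - r%:R^-1) * ((\sum_t a t ^+ 2) `^ 2^-1) `^ (r%:R^-1) * M.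
Proof.
case: r => // r _ a0 g0 M0 gM.
have r0 : r.+1%:R != 0 :> R by rewrite pnatr_eq0.
have A0 : 0 <= \sum_t a t by exact: sumr_ge0.
have B0 : 0 <= \sum_t a t ^+ 2 by apply: sumr_ge0 => t _; exact: sqr_ge0.
have s0 : 0 <= \sum_t a t * g t by apply: sumr_ge0 => t _; rewrite mulr_ge0.
rewrite -(@ler_pXn2r _ (2 * r.+1)) ?nnegrE ?mulr_ge0 ?powR_ge0 ?muln_gt0 //.
apply: le_trans (sum_hoelder_even _ a0 g0) _.
rewrite [leRHS]exprMn; apply: ler_pM; [by rewrite mulr_ge0 // exprn_ge0| |  |exact: gM].
  by apply: sumr_ge0 => t _; rewrite exprn_ge0.
rewrite exprMn -!powR_mulrn ?powR_ge0 // -!powRrM.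
have -> : (1 - r.+1%:R^-1) * (2 * r.+1)%:R = (2 * r)%:R :> R.
  by rewrite !natrM -[r.+1%:R]natr1; field; rewrite natr1.
have -> : 2^-1 * (r.+1%:R^-1 * (2 * r.+1)%:R) = 1 :> R.
  by rewrite natrM; field.
by rewrite powRr1 // powR_mulrn.
Qed.

(** * Moments of the Kloosterman sums over an interval, and congruences between reciprocals *)

Lemma ler_sum_injective (R : numDomainType) (S T : finType) (e : S -> T) (h : T -> R) :
  injective e -> (forall t, 0 <= h t) -> \sum_s h (e s) <= \sum_t h t.
Proof.
move=> ie h0; rewrite [leRHS](bigID (mem [set e x | x in S])) /= big_imset /=; last first.
  by move=> x y _ _; exact: ie.
by rewrite lerDl sumr_ge0.
Qed.

Definition to_signed (K : nat) (z : int) : bool * 'I_K.+1 := (z < 0, inord (absz z).-1).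

Lemma to_signedK (K : nat) (z : int) : z != 0 -> (absz z <= K.+1)%N ->
  signed_int (to_signed K z) = z.
Proof.
move=> z0 zK; have zp : (0 < absz z)%N by rewrite absz_gt0.
by rewrite /signed_int /= inordK ?prednK // [RHS]intEsign.
Qed.

Lemma normC_normc (R : realType) (z : R[i]) : `|z| = (Normc.normc z)%:C.
Proof. by case: z. Qed.

Lemma normc_ge0 (R : realType) (z : R[i]) : 0 <= Normc.normc z.
Proof. by rewrite -lecR rmorph0 -normC_normc. Qed.

Section Moments.
Variables (R : realType) (q : nat).
Hypothesis q1 : (1 < q)%N.

Definition interval_char (L N : nat) (x : {unit 'Z_q}) : R[i] :=
  \sum_(L.+1 <= n < (L + N).+1) zp_char R (n%:R * val x).

Definition kloosterman_interval (L N : nat) (m : 'Z_q) : R[i] :=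
  \sum_x interval_char L N x * zp_char R (m * (val x)^-1).

(** Substituting the inverse of [x] attaches [n] to [x] and [m] to its inverse, so the sum over [n]
    becomes geometric. *)
Lemma kloosterman_bilinearE (alpha : {unit 'Z_q} -> R[i]) (L N : nat) :
  kloosterman_bilinear alpha L N = \sum_m alpha m * kloosterman_interval L N (val m).
Proof.
apply: eq_bigr => m _; rewrite -mulr_sumr; congr (_ * _).
rewrite /kloosterman exchange_big /= /kloosterman_interval (reindex_inj invg_inj) /=.
apply: eq_bigr => x _; rewrite invgK /interval_char mulr_suml; apply: eq_bigr => n _.
rewrite -(zp_char_int R q1) rmorphD !rmorphM /= -!pmulrn /unit_repr !natr_Zp.
by rewrite (zp_charD R q1) mulrC FinRing.val_unitV.
Qed.

Lemma interval_char_bounds (L N : nat) (x : {unit 'Z_q}) :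
  Normc.normc (interval_char L N x) <= N%:R /\
  Normc.normc (interval_char L N x) * (absz (centered_rep (val x)))%:R <= q%:R.
Proof.
have [] := zp_char_geometric_bound R q1 (val x) L N.
by rewrite !normC_normc -!(rmorph_nat (real_complex R)) -rmorphM !lecR.
Qed.

(** By positivity [m] may run over all residues, where orthogonality applies. *)
Lemma kloosterman_interval_moment (r L N : nat) :
  \sum_(m : {unit 'Z_q}) Normc.normc (kloosterman_interval L N (val m)) ^+ (2 * r) <=
  q%:R * \sum_(f : {ffun bool * 'I_r -> {unit 'Z_q}} |
                 \sum_(i : bool * 'I_r) (-1) ^+ i.1 * (val (f i))^-1 == 0 :> 'Z_q)
    \prod_i Normc.normc (interval_char L N (f i)).
Proof.
apply: (@le_trans _ _
  (\sum_(m : 'Z_q) Normc.normc (kloosterman_interval L N m) ^+ (2 * r))).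
  apply: (@ler_sum_injective _ _ _ val
    (fun m => Normc.normc (kloosterman_interval L N m) ^+ (2 * r))).
    exact: val_inj.
  by move=> m; rewrite exprn_ge0 // normc_ge0.
have := zp_char_moment q1 r (interval_char L N).
rewrite -lecR rmorph_sum rmorphM rmorph_sum /= rmorph_nat.
by under eq_bigr do rewrite normC_normc -rmorphXn; under [X in _ <= _ * X -> _]eq_bigr do
  under eq_bigr do rewrite normC_normc; under [X in _ -> _ <= _ * X]eq_bigr do rewrite rmorph_prod.
Qed.

End Moments.

Section Reciprocals.
Variables (R : realType) (I : finType) (s : I -> bool).

Notation num f := (recip_num s (fun i => signed_int (f i))).

(** Multiplying the congruence by the product of all the units clears the denominators. *)
Lemma dvd_recip_num_centered (q : nat) (f : I -> {unit 'Z_q}) : (1 < q)%N ->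
  \sum_i (-1) ^+ s i * (val (f i))^-1 == 0 :> 'Z_q ->
  (q %| absz (recip_num s (fun i => centered_rep (val (f i)))))%N.
Proof.
move=> q1 /eqP sum0; rewrite -intr_Zp_eq0 // /recip_num rmorph_sum /=.
have fE i : (centered_rep (val (f i)))%:~R = val (f i) by rewrite centered_repE.
rewrite (eq_bigr (fun i => (\prod_j val (f j)) * ((-1) ^+ s i * (val (f i))^-1))).
  by rewrite -mulr_sumr sum0 mulr0.
move=> i _; rewrite rmorphM rmorphXn rmorphN1 rmorph_prod /=.
under eq_bigr do rewrite fE.
rewrite [in RHS](bigD1 i) //= [RHS]mulrCA; congr (_ * _).
by rewrite mulrAC mulrV ?mul1r //; exact: valP.
Qed.

Lemma prod_le_sqrt_recip (F a : I -> R) (A : R) (r : nat) : #|I| = (2 * r)%N ->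
  (forall i, 0 <= F i) -> (forall i, 0 < a i) -> 0 <= A ->
  (forall i, F i ^+ 2 * a i <= A) ->
  \prod_i F i <= A ^+ r * (Num.sqrt (\prod_i a i))^-1.
Proof.
move=> cI F0 a0 A0 FA; have pa0 : 0 < \prod_i a i by exact: prodr_gt0.
have pF0 : 0 <= \prod_i F i by exact: prodr_ge0.
rewrite ler_pdivlMr ?sqrtr_gt0 // -(@ler_pXn2r _ 2) ?nnegrE ?mulr_ge0 ?sqrtr_ge0 ?exprn_ge0 //.
rewrite exprMn sqr_sqrtr ?(ltW pa0) // -exprM mulnC -cI -prodr_const -prodrXl -big_split /=.
by apply: ler_prod => i _; rewrite FA mulr_ge0 ?exprn_ge0 // ltW.
Qed.

Lemma prod_le_recip (F a : I -> R) (A : R) :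
  (forall i, 0 <= F i) -> (forall i, 0 < a i) -> (forall i, F i * a i <= A) ->
  \prod_i F i <= A ^+ #|I| * \prod_i (a i)^-1.
Proof.
move=> F0 a0 FA; rewrite -prodr_const -big_split /=.
by apply: ler_prod => i _; rewrite F0 /= ler_pdivlMr.
Qed.

(** Centered representatives embed the unit tuples injectively into the signed tuples. A congruence
    solution is diagonal if its integer numerator vanishes; otherwise [q] divides that nonzero
    numerator. Each case uses its own bound on the product of the [F (f i)]. *)
Lemma reciprocal_solutions_split (q K r N : nat) (F : {unit 'Z_q} -> R) :
  (1 < q)%N -> (q <= K.+1)%N -> #|I| = (2 * r)%N ->
  (forall x, 0 <= F x) -> (forall x, F x <= N%:R) ->
  (forall x, F x * (absz (centered_rep (val x)))%:R <= q%:R) ->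
  \sum_(f : {ffun I -> {unit 'Z_q}} | \sum_i (-1) ^+ s i * (val (f i))^-1 == 0 :> 'Z_q)
     \prod_i F (f i) <=
  (N%:R * q%:R) ^+ r * diagonal_sum R s K.+1 + q%:R ^+ (2 * r) * offdiagonal_sum R s K.+1 q.
Proof.
move=> q1 qK cI F0 FN Fq.
have c0 (x : {unit 'Z_q}) : centered_rep (val x) != 0.
  apply/eqP => c; have := valP x; have := centered_repE q1 (val x).
  by rewrite c mulr0z => <-; rewrite unitr0.
have cK (x : {unit 'Z_q}) : (absz (centered_rep (val x)) <= K.+1)%N.
  by apply: leq_trans qK; have := centered_rep_le q1 (val x); lia.
pose sg (x : {unit 'Z_q}) := to_signed K (centered_rep (val x)).
have sgK x : signed_int (sg x) = centered_rep (val x) by rewrite to_signedK.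
pose emb (f : {ffun I -> {unit 'Z_q}}) := [ffun i => sg (f i)].
have emb_inj : injective emb.
  move=> f g /ffunP fg; apply/ffunP => i; apply: val_inj.
  rewrite -[LHS](centered_repE q1) -[RHS](centered_repE q1) -!sgK.
  by have := fg i; rewrite !ffunE => ->.
have numE f : num (emb f) = recip_num s (fun i => centered_rep (val (f i))).
  by congr recip_num; apply/funext => i; rewrite ffunE sgK.
pose h (g : {ffun I -> bool * 'I_K.+1}) : R :=
  (N%:R * q%:R) ^+ r * (if num g == 0 then
     (Num.sqrt (\prod_i (absz (signed_int (g i)))%:R))^-1 else 0) +
  q%:R ^+ (2 * r) * (if (num g != 0) && (q %| absz (num g))%N then
     \prod_i (absz (signed_int (g i)))%:R^-1 else 0).
have h0 g : 0 <= h g.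
  apply: addr_ge0; apply: mulr_ge0; rewrite ?exprn_ge0 ?mulr_ge0 //; case: ifP => // _.
  by rewrite prodr_ge0.
have -> : (N%:R * q%:R) ^+ r * diagonal_sum R s K.+1 + q%:R ^+ (2 * r) * offdiagonal_sum R s K.+1 q
    = \sum_g h g.
  by rewrite /h big_split /= -!mulr_sumr -!big_mkcond.
apply: le_trans (ler_sum_injective emb_inj h0).
rewrite big_mkcond; apply: ler_sum => f _; case: ifP => [sum0|_]; last exact: h0.
have a0 i : 0 < (absz (signed_int (emb f i)))%:R :> R.
  by rewrite ffunE sgK ltr0n absz_gt0.
rewrite /h; case: eqP => [_|_] /=.
  rewrite mulr0 addr0; apply: prod_le_sqrt_recip => // i.
  (* The product of the two bounds: [F ^ 2 * |x| <= N * q]. *)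
  by rewrite ffunE sgK expr2 -mulrA ler_pM ?mulr_ge0.
rewrite numE dvd_recip_num_centered // mulr0 add0r -cI.
by apply: prod_le_recip => // i; rewrite ffunE sgK.
Qed.

(** Markov's inequality over the moduli. *)
Lemma large_offdiagonal_count (K : nat) (E : {fset nat}) (C B : R) :
  (forall E : seq nat, uniq E -> \sum_(q <- E) offdiagonal_sum R s K q <= C) ->
  (forall q, q \in E -> B <= offdiagonal_sum R s K q) ->
  (#|` E|)%:R * B <= C.
Proof.
move=> hC hB; apply: le_trans (hC _ (fset_uniq E)).
rewrite mulr_natl.
have -> : B *+ #|` E| = \sum_(q <- E) B by rewrite big_const_seq count_predT iter_addr_0.
by rewrite big_seq [leRHS]big_seq; exact: ler_sum.
Qed.

End Reciprocals.

(** * Combining the estimates and counting the exceptional moduli *)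

Lemma exprD_superadditive (R : numDomainType) (x y : R) (n : nat) :
  0 <= x -> 0 <= y -> x ^+ n.+1 + y ^+ n.+1 <= (x + y) ^+ n.+1.
Proof.
move=> x0 y0; elim: n => [|n IH]; first by rewrite !expr1.
rewrite [leRHS]exprS; apply: (@le_trans _ _ ((x + y) * (x ^+ n.+1 + y ^+ n.+1))).
  rewrite mulrDl !mulrDr -!exprS lerD // ?lerDl ?lerDr ?mulr_ge0 ?exprn_ge0 //.
by rewrite ler_wpM2l ?addr_ge0.
Qed.

(** The off-diagonal part is at most [x ^ (2r)] and the diagonal part at most [c * y ^ (2r)], with
    [x] and [y] the two terms of the final bound; the extra factor [q] in front yields the [1/(2r)]
    in the exponent of [y]. Superadditivity of powers merges them. *)
Lemma moment_power_bound (R : realType) (eps delta c T : R) (q N r : nat) :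
  0 < eps -> 0 < delta -> 0 <= c -> (0 < q)%N -> (0 < r)%N -> 0 <= T ->
  q%:R * T <= q%:R `^ (2 * r%:R * eps + delta) ->
  q%:R * ((N%:R * q%:R) ^+ r * (c * q%:R `^ delta) + q%:R ^+ (2 * r) * T) <=
  ((c + 1) * ((q%:R + N%:R `^ 2^-1 * q%:R `^ (2^-1 + (2 * r%:R)^-1)) * q%:R `^ (eps + delta)))
    ^+ (2 * r).
Proof.
move=> e0 d0 c0 q0 r0 T0 hT.
have q1 : 1 <= q%:R :> R by rewrite ler1n.
have qp : 0 < q%:R :> R by rewrite ltr0n.
have qn0 : q%:R != 0 :> R by rewrite lt0r_neq0.
have rn0 : r%:R != 0 :> R by rewrite pnatr_eq0 -lt0n.
have r1 : 1 <= r%:R :> R by rewrite ler1n.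
have c1 : 1 <= c + 1 by rewrite lerDr.
have c1p : 0 <= c + 1 by rewrite addr_ge0.
set x := q%:R * q%:R `^ (eps + delta).
set y := N%:R `^ 2^-1 * q%:R `^ (2^-1 + (2 * r%:R)^-1) * q%:R `^ (eps + delta).
have x0 : 0 <= x by rewrite mulr_ge0 ?powR_ge0.
have y0 : 0 <= y by rewrite !mulr_ge0 ?powR_ge0.
have xyn : x ^+ (2 * r) + y ^+ (2 * r) <= (x + y) ^+ (2 * r).
  by rewrite -[(2 * r)%N]prednK ?muln_gt0 // exprD_superadditive.
have pow2r a : (q%:R `^ a) ^+ (2 * r) = q%:R `^ (a * (2 * r%:R)) :> R.
  by rewrite -powR_mulrn ?powR_ge0 // -powRrM natrM.
have hx : q%:R * (q%:R ^+ (2 * r) * T) <= x ^+ (2 * r).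
  rewrite mulrCA /x exprMn ler_wpM2l ?exprn_ge0 // pow2r; apply: le_trans hT _.
  by apply: ler_powR => //; nra.
have hy : q%:R * ((N%:R * q%:R) ^+ r * q%:R `^ delta) <= y ^+ (2 * r).
  rewrite /y !exprMn !pow2r.
  have -> : (N%:R `^ 2^-1) ^+ (2 * r) = N%:R ^+ r :> R.
    by rewrite exprM -[_ ^+ 2]powR_mulrn ?powR_ge0 // -powRrM mulVf // powRr1.
  rewrite mulrCA -!mulrA ler_wpM2l ?exprn_ge0 //.
  have -> : (2^-1 + (2 * r%:R)^-1) * (2 * r%:R) = r%:R + 1 :> R by field.
  rewrite powRD ?qn0 ?implybT // powRr1 ?ler0n // powR_mulrn ?ler0n // -mulrA.
  rewrite ler_wpM2l ?exprn_ge0 // ler_wpM2l //.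
  by apply: ler_powR => //; nra.
rewrite [(_ + _) * q%:R `^ _]mulrDl -/x -/y [leRHS]exprMn.
apply: (@le_trans _ _ ((c + 1) * (x + y) ^+ (2 * r))); last first.
  by rewrite ler_wpM2r ?exprn_ge0 ?addr_ge0 // ler_eXnr ?muln_gt0.
apply: le_trans (ler_wpM2l c1p xyn).
have -> : q%:R * ((N%:R * q%:R) ^+ r * (c * q%:R `^ delta) + q%:R ^+ (2 * r) * T) =
    c * (q%:R * ((N%:R * q%:R) ^+ r * q%:R `^ delta)) + q%:R * (q%:R ^+ (2 * r) * T) by ring.
have := ler_wpM2l c0 hy; have := mulr_ge0 c0 (exprn_ge0 (2 * r) x0).
have := exprn_ge0 (2 * r) y0; lra.
Qed.

Theorem theorem2p2 (R : realType) (eps : R) (r : nat)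
    (heps : 0 < eps) (hr : (2 <= r)%N) :
  forall delta : R, 0 < delta ->
  exists Q0 C : R, [/\ 1 < Q0, 0 < C &
    forall Q : R, Q0 <= Q ->
    exists E : {fset nat},
      (#|` E|)%:R <= Q `^ (1 - 2 * r%:R * eps + delta) /\
      forall q : nat, Q <= q%:R <= 2 * Q -> q \notin E ->
      forall (L N : nat) (alpha : {unit 'Z_q} -> R[i]), (L + N < q)%N ->
        Normc.normc (kloosterman_bilinear alpha L N) <=
          C * (weight_norm 1 alpha `^ (1 - r%:R^-1)
               * weight_norm 2 alpha `^ (r%:R^-1)
               * (q%:R + N%:R `^ (2^-1) * q%:R `^ (2^-1 + (2 * r%:R)^-1))
               * q%:R `^ (eps + delta))].
Proof.
move=> delta d0; pose I := (bool * 'I_r)%type; pose s (i : I) := i.1.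
have cI : #|{: I}| = (2 * r)%N by rewrite card_prod card_bool card_ord.
have r0 : (0 < r)%N by exact: ltnW.
have [C1 C1p hC1] := @diagonal_sum_bound R I _ d0.
have [C2 C2p hC2] := @offdiagonal_sum_bound R I _ d0.
have D3 : 0 < 3 `^ delta :> R by rewrite powR_gt0.
pose c := C1 * 3 `^ delta; have c0 : 0 < c by rewrite mulr_gt0.
pose B := 2 * C2 * 3 `^ delta; have B0 : 0 < B by rewrite !mulr_gt0.
(* The bound [2 <= Q] makes every [q] exceed [1], and [B]^ delta^-1 <= Q[lets]Q [^ delta] absorb the
   constant [B] in the count of exceptions. *)
exists (Num.max 2 (B `^ delta^-1)), (c + 1); split.
- by rewrite lt_max ltr1n.
- by rewrite addr_gt0.
move=> Q; rewrite ge_max => /andP[Q2 QB].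
have Q0 : 0 < Q by lra.
(* One range [K.+1], of size at most [3 * Q], serves all moduli up to [2 * Q]. *)
pose K := Num.trunc (2 * Q).
have KQ : K.+1%:R <= 3 * Q.
  have : K%:R <= 2 * Q by rewrite truncn_le // mulr_ge0 // ltW.
  by rewrite -natr1; lra.
have Kpow : K.+1%:R `^ delta <= 3 `^ delta * Q `^ delta.
  by rewrite -powRM ?(ltW Q0) //; apply: ge0_ler_powR;
    rewrite ?nnegrE ?mulr_ge0 ?(ltW Q0) ?(ltW d0).
pose T q := offdiagonal_sum R s K.+1 q.
(* A modulus is exceptional when its off-diagonal sum is too large for [moment_power_bound]; this
   depends on neither the interval nor the weights. *)
pose bad q := (Q <= q%:R) && (q%:R `^ (2 * r%:R * eps + delta) < q%:R * T q).
pose E := seq_fset tt [seq q <- iota 0 K.+1 | bad q].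
have inE' q : (q \in E) = (q < K.+1)%N && bad q.
  by rewrite seq_fsetE mem_filter mem_iota add0n andbC.
have qK q : q%:R <= 2 * Q -> (q < K.+1)%N.
  by move=> qQ; rewrite -(@ltr_nat R); apply: le_lt_trans qQ (truncnS_gt _).
exists E; split.
  have h : #|` E|%:R * (Q `^ (2 * r%:R * eps + delta) / (2 * Q)) <= C2 * K.+1%:R `^ delta.
    apply: (@large_offdiagonal_count R I s K.+1 E).
      by move=> S uS; exact: hC2.
    move=> q; rewrite inE' => /andP[qK' /andP[Qq hq]].
    have q0 : 0 < q%:R :> R by exact: lt_le_trans Qq.
    have qQ : q%:R <= 2 * Q.
      apply: (@le_trans _ _ K%:R); first by rewrite ler_nat -ltnS.
      by rewrite truncn_le // mulr_ge0 // ltW.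
    have powle : Q `^ (2 * r%:R * eps + delta) <= q%:R `^ (2 * r%:R * eps + delta).
      by apply: ge0_ler_powR;
        rewrite ?nnegrE ?addr_ge0 ?mulr_ge0 ?(ltW Q0) ?(ltW q0) ?(ltW d0) ?(ltW heps).
    rewrite ler_pdivrMr ?mulr_gt0 //; apply: le_trans powle _; apply: (le_trans (ltW hq)).
    rewrite mulrC ler_wpM2l //; apply: sumr_ge0 => f _; exact: prodr_ge0.
  have Bd : B <= Q `^ delta.
    have BQ : B `^ delta^-1 `^ delta <= Q `^ delta.
      by apply: ge0_ler_powR; rewrite ?nnegrE ?powR_ge0 ?(ltW d0) ?(ltW Q0).
    by rewrite -powRrM mulVf ?powRr1 ?(ltW B0) ?lt0r_neq0 in BQ.
  have Qn0 : Q != 0 by rewrite lt0r_neq0.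
  have Q1 : Q `^ 1 = Q by rewrite powRr1 // ltW.
  rewrite !powRD ?Qn0 ?implybT // powRN Q1.
  set P := Q `^ (2 * r%:R * eps); have P0 : 0 < P by rewrite powR_gt0.
  have Qd0 : 0 < Q `^ delta by rewrite powR_gt0.
  move: h; rewrite powRD ?Qn0 ?implybT // -/P => h.
  (* The factor [Q]^ delta[in the threshold cancels the one from the total off-diagonal mass, so the
     allowed loss]Q [^ delta] remains free to absorb [B]. *)
  have {}h : #|` E|%:R * P <= B * Q.
    rewrite -(ler_pM2r Qd0); have := le_trans h (ler_wpM2l (ltW C2p) Kpow).
    rewrite mulrA ler_pdivrMr ?mulr_gt0 // mulrA => /le_trans; apply.
    by rewrite /B le_eqVlt; apply/orP; left; apply/eqP; ring.
  rewrite mulrAC ler_pdivlMr //; apply: (le_trans h).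
  by rewrite mulrC ler_wpM2l // ltW.
move=> q /andP[Qq qQ] qE L N alpha _.
have q1 : (1 < q)%N by rewrite -(@ltr_nat R); lra.
have hT : q%:R * T q <= q%:R `^ (2 * r%:R * eps + delta).
  by move: qE; rewrite inE' qK //= /bad Qq /= -leNgt.
have T0 : 0 <= T q by apply: sumr_ge0 => f _; rewrite prodr_ge0.
rewrite kloosterman_bilinearE //.
set g := fun m : {unit 'Z_q} => Normc.normc (kloosterman_interval R L N (val m)).
have mom : \sum_m g m ^+ (2 * r) <=
    ((c + 1) * ((q%:R + N%:R `^ 2^-1 * q%:R `^ (2^-1 + (2 * r%:R)^-1)) * q%:R `^ (eps + delta)))
      ^+ (2 * r).
  apply: le_trans (moment_power_bound N heps d0 (ltW c0) (ltnW q1) r0 T0 hT).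
  apply: le_trans (kloosterman_interval_moment _ q1 r L N) _.
  rewrite ler_wpM2l //.
  pose F (x : {unit 'Z_q}) := Normc.normc (interval_char R L N x).
  apply: (le_trans (@reciprocal_solutions_split R I s q K r N F q1 (ltnW (qK _ qQ)) cI _ _ _)).
  - by move=> x; exact: normc_ge0.
  - by move=> x; have [] := interval_char_bounds R q1 L N x.
  - by move=> x; have [] := interval_char_bounds R q1 L N x.
  rewrite lerD2r ler_wpM2l ?exprn_ge0 ?mulr_ge0 //; apply: (le_trans (hC1 _ s _)) => //.
  rewrite /c -mulrA ler_wpM2l ?(ltW C1p) //; apply: (le_trans Kpow).
  rewrite ler_wpM2l ?(ltW D3) //; apply: ge0_ler_powR; rewrite ?nnegrE ?(ltW Q0) ?(ltW d0) //.
have -> : weight_norm 1 alpha = \sum_m Normc.normc (alpha m).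
  rewrite /weight_norm invr1 powRr1; last by apply: sumr_ge0 => m _; exact: powR_ge0.
  by apply: eq_bigr => m _; rewrite powRr1 // normc_ge0.
have -> : weight_norm 2 alpha = (\sum_m Normc.normc (alpha m) ^+ 2) `^ 2^-1.
  by congr (_ `^ _); apply: eq_bigr => m _; rewrite powR_mulrn // normc_ge0.
apply: (@le_trans _ _ (\sum_m Normc.normc (alpha m) * g m)).
  rewrite -lecR -normC_normc rmorph_sum; apply: le_trans (ler_norm_sum _ _ _) _.
  by apply: ler_sum => m _; rewrite normrM !normC_normc -rmorphM.
apply: le_trans (sum_hoelder_powR r0 _ _ _ mom) _.
- by move=> m; exact: normc_ge0.
- by move=> m; exact: normc_ge0.
- apply: mulr_ge0; first by rewrite addr_ge0 // ltW.
  by rewrite mulr_ge0 ?addr_ge0 ?mulr_ge0 ?powR_ge0.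
by rewrite mulrCA !mulrA.
Qed.
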